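(* Let $p\in(1,\infty)$ and let $\mu_0,\mu_1$ be finite positive Borel measures on $\mathbb{R}$ supported on $\Delta_0=[a,b]$ and $\Delta_1=[c,d]$ respectively, where $a,b,c,d\in\mathbb{R}$, $a<b$, $c\le d$, such that $\mathring{\Delta}_0\cap\mathring{\Delta}_1=\emptyset$, so that $b\le c$ or $d\le a$. Let $n\ge1$ and let $L_n$ be the $n$th monic extremal polynomial relative to the Sobolev norm $\|f\|_{S,p}=\left(\int_{\Delta_0}|f|^p\,d\mu_0+\int_{\Delta_1}|f'|^p\,d\mu_1\right)^{1/p}$. Then all the zeros of $L_n$ lie in $$D_\Delta=\begin{cases}\mathbf{D}(d,d-a)\cup\mathbf{D}(a,b-a), & \text{if } b\le c,\\ \mathbf{D}(c,b-c)\cup\mathbf{D}(b,b-a), & \text{if } d\le a,\end{cases}$$ where $\mathbf{D}(w,r)=\{z\in\mathbb{C}:|z-w|<r\}$.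
   Context: $\mathring{A}$ is the interior of $A$ in $\mathbb{R}$. ''Supported on $\Delta_k$'' means that the support of $\mu_k$ is contained in $\Delta_k$; the support of $\mu_0$ is assumed to be an infinite set. $L_n$ is the unique monic polynomial of exact degree $n$ minimizing $\|Q\|_{S,p}$ among all monic polynomials $Q$ of degree $n$ (complex coefficients allowed). *)

(* Defs.v *)
From HB Require Import structures.
From mathcomp Require Import all_boot all_order all_algebra.
From mathcomp Require Import complex.
From mathcomp Require Import all_classical all_reals all_analysis.
Set Implicit Arguments.
Unset Strict Implicit.
Unset Printing Implicit Defensive.
Import Order.TTheory GRing.Theory Num.Theory.
Import numFieldNormedType.Exports.
Local Open Scope classical_set_scope.
Local Open Scope ring_scope.
Local Open Scope complex_scope.

Definition measure_support (R : realType)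
    (mu : {measure set (measurableTypeR R) -> \bar R}) : set R :=
  [set x | forall U : set R, open U -> U x -> (0 < mu U)%E].

(* |z| as an element of R: in mathcomp-real-closed, `|z| lives in R[i]. *)
Definition cabs (R : realType) (z : R[i]) : R := complex.Re `|z|.

(* (\int_[a,b] |Q|^p dmu0 + \int_[c,d] |Q'|^p dmu1)^(1/p), for a polynomial Q
   with complex coefficients evaluated at real points. *)
Definition sobolev_norm (R : realType) (p a b c d : R)
    (mu0 mu1 : {measure set (measurableTypeR R) -> \bar R})
    (Q : {poly R[i]}) : \bar R :=
  ((\int[mu0]_(x in `[a, b]) ((cabs Q.[(x : R)%:C]) `^ p)%:E
    + \int[mu1]_(x in `[c, d]) ((cabs Q^`().[(x : R)%:C]) `^ p)%:E) `^ p^-1)%E.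

Definition monic_of_degree (R : realType) (n : nat) (Q : {poly R[i]}) : Prop :=
  Q \is monic /\ size Q = n.+1.

Definition extremal_poly (R : realType) (p a b c d : R)
    (mu0 mu1 : {measure set (measurableTypeR R) -> \bar R})
    (n : nat) (L : {poly R[i]}) : Prop :=
  monic_of_degree n L /\
  forall Q : {poly R[i]}, monic_of_degree n Q ->
    (sobolev_norm p a b c d mu0 mu1 L <= sobolev_norm p a b c d mu0 mu1 Q)%E.

(* The open disc D(w, r) of the complex plane, with a real center. *)
Definition disc (R : realType) (w r : R) : set R[i] :=
  [set z | cabs (z - w%:C) < r].

(* Meant for a < b and (b <= c or d <= a), with c <= d; the two cases are then
   mutually exclusive, so the second branch is the case d <= a. *)
Definition D_Delta (R : realType) (a b c d : R) : set R[i] :=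
  if b <= c then disc d (d - a) `|` disc a (b - a)
  else disc c (b - c) `|` disc b (b - a).

(* Main.v *)
Require Import Defs.
From HB Require Import structures.
From mathcomp Require Import all_boot all_order all_algebra.
From mathcomp Require Import complex polyrcf ring lra.
From mathcomp Require Import all_classical all_reals all_analysis.
From mathcomp Require Import measurable_realfun.
Import Order.TTheory GRing.Theory Num.Theory.
Import numFieldNormedType.Exports.
Set Implicit Arguments.
Unset Strict Implicit.
Unset Printing Implicit Defensive.
Local Open Scope classical_set_scope.
Local Open Scope ring_scope.

(* Replacing L by its real part does not increase the Sobolev norm, so L is real.
   If a nonzero polynomial Q of degree < n satisfied L Q >= 0 on [a, b] and
   L' Q' >= 0 on [c, d], then L - t Q would beat L for small t > 0: the norm^p
   decreases by a multiple of t, up to an error O(t^p) with p > 1.  Applied to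
   Hermite interpolants Q sharing the sign changes of L in (a, b) and those of
   L' in (c, d), this forces L to have a zero x0 in (a, b) and, by counting with
   Rolle's theorem, all the critical points of L to be real and in [a, d] (in the
   case b <= c; the other case follows by reflection).  By the Grace-Heawood
   bisector theorem, for any other zero z of L some critical point is at least as
   close to z as to x0, hence one of the endpoints a, d is, which places z in one
   of the two discs. *)

(** * The bisector theorem *)

(** Positive exactly when [r] is strictly closer to [x] than to [z]: for [x != z], an open
    half-plane bounded by the perpendicular bisector. Squaring the distances makes the gap
    real-affine in [r]. *)
Definition bisector_gap (C : numClosedFieldType) (x z r : C) : C :=
  `|z - r| ^+ 2 - `|x - r| ^+ 2.

Lemma bisector_gap_real (C : numClosedFieldType) (x z r : C) :
  bisector_gap x z r \is Num.real.
Proof. by rewrite rpredB // rpredX // normr_real. Qed.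

(** Inversion about [r] turns the half-plane of nonpositive gap into [h |v|^2 <= 2 Re (v (z - x))],
    where [h] is the gap at [r]; for [h > 0] this is a disc. *)
Lemma bisector_gapE (C : numClosedFieldType) (x z r v : C) : v != 0 ->
  bisector_gap x z (r + v^-1) * `|v| ^+ 2 =
  bisector_gap x z r * `|v| ^+ 2 - (v * (z - x) + (v * (z - x))^*).
Proof.
move=> v0; have w0 : v^* != 0 by rewrite conjC_eq0.
rewrite /bisector_gap !normCK !(rmorphB, rmorphD, rmorphM, fmorphV) /=.
by field; rewrite v0 w0.
Qed.

(** This is Laguerre's theorem on polar derivatives, for the polynomial [Lam (g * ('X - s)^n.+1)] in
    [s]. If its polarisation vanished at [zeta, r, ..., r], the substitution [s = r + v^-1] would
    make [(zeta - r)^-1] the mean of the transformed roots. *)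
Lemma walsh_step (C : numClosedFieldType) (Lam : {scalar {poly C}})
    (x z zeta r : C) (n : nat) (g : {poly C}) :
    (forall s, 0 < bisector_gap x z s -> Lam (g * ('X - s%:P) ^+ n.+1) != 0) ->
    0 < bisector_gap x z zeta -> 0 < bisector_gap x z r ->
  Lam (('X - zeta%:P) * g * ('X - r%:P) ^+ n) != 0.
Proof.
move=> Hg hzeta hr; apply/eqP => L0.
pose A k := Lam (g * ('X - r%:P) ^+ k).
have A1 : A n.+1 != 0 by exact: Hg.
(* Split ['X - r] as [('X - zeta) + (zeta - r)]; [L0] kills the first part. *)
have A1E : A n.+1 = (zeta - r) * A n.
  rewrite /A -[RHS]linearZ /= -[LHS]subr0 -L0 -linearB /=; congr (Lam _).
  by rewrite exprS -mul_polyC rmorphB /=; ring.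
have zr : zeta - r != 0 by apply: contraNneq A1 => e; rewrite A1E e mul0r.
have An0 : A n != 0 by apply: contraNneq A1 => e; rewrite A1E e mulr0.
(* Every root [v] of [Phi] is 0 or has [r + v^-1] in the half-plane of
   nonpositive gap; these [v] form a disc, which is convex and hence contains
   the mean [(zeta - r)^-1] of the roots, contradicting [hzeta]. *)
pose Phi := \poly_(k < n.+2) ((-1) ^+ (n.+1 - k) * A k *+ 'C(n.+1, k)).
have PhiE v : Phi.[v] = Lam (g * (v *: ('X - r%:P) - 1) ^+ n.+1).
  rewrite horner_poly addrC exprDn mulr_sumr linear_sum; apply: eq_bigr => i _.
  rewrite mulrnAr raddfMn mulrnAl; congr (_ *+ _); rewrite exprZn.
  rewrite [g * _](_ : _ = ((-1) ^+ (n.+1 - i) * v ^+ i) *: (g * ('X - r%:P) ^+ i)).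
    by rewrite /= scalarZ mulrAC.
  by rewrite -!mul_polyC rmorphM !rmorphXn /= rmorphN1; ring.
have sPhi : size Phi = n.+2.
  by rewrite size_poly_eq // subnn expr0 mul1r binn mulr1n.
have lcPhi : lead_coef Phi = A n.+1.
  by rewrite lead_coefE sPhi coef_poly ltnSn subnn expr0 mul1r binn mulr1n.
have [rs Phirs] := closed_field_poly_normal Phi.
have srs : size rs = n.+1.
  by move: sPhi; rewrite Phirs lcPhi size_scale // size_prod_XsubC => -[].
(* Vieta: the coefficient of degree [n] is [A n] times [- n.+1], and the leading one is [A n] times
   [zeta - r]. *)
have sum_rs : \sum_(v <- rs) v = (zeta - r)^-1 *+ n.+1.
  have := erefl Phi`_n; rewrite {2}Phirs coefZ lcPhi.
  rewrite -[in X in _ = _ * X]/(n.+1.-1) -srs coefPn_prod_XsubC ?srs //.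
  rewrite coef_poly leqnSn subSnn expr1 A1E binSn.
  rewrite mulN1r mulrN mulNrn => /oppr_inj e.
  by apply: (mulfI (mulf_neq0 zr An0)); rewrite -e mulrnAr mulrAC mulfV // mul1r.
pose m := (zeta - r)^-1.
have m0 : m != 0 by rewrite invr_eq0.
have Kv v : v \in rs -> bisector_gap x z r * `|v| ^+ 2 <=
    v * (z - x) + (v * (z - x))^*.
  move=> vrs; have [->|v0] := eqVneq v 0.
    by rewrite mul0r conjC0 normr0 expr0n mulr0 addr0.
  rewrite -subr_le0 -bisector_gapE // pmulr_lle0 ?exprn_gt0 ?normr_gt0 //.
  rewrite real_leNgt ?bisector_gap_real ?real0 //; apply/negP => /Hg /negP; apply.
  have : Phi.[v] == 0.
    rewrite Phirs hornerZ; apply/eqP; rewrite [X in _ * X](_ : _ = 0) ?mulr0 //.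
    by apply/rootP; rewrite root_prod_XsubC.
  rewrite PhiE (_ : v *: _ - 1 = v *: ('X - (r + v^-1)%:P)).
    by rewrite exprZn -scalerAr linearZ /= mulf_eq0 expf_eq0 (negbTE v0) andbF.
  rewrite rmorphD /= opprD addrA [RHS]scalerBr; congr (_ - _).
  by rewrite -mul_polyC -rmorphM /= mulfV.
(* Since [|v - m|^2 >= 0], [|v|^2] may be replaced by its tangent at [m], which is real-affine in
   [v]; summing over the roots then evaluates the inequality at their mean. *)
have Kv' v : v \in rs -> bisector_gap x z r * (v * m^* + v^* * m - m * m^*) <=
    v * (z - x) + (v * (z - x))^*.
  move=> /Kv; apply: le_trans; apply: ler_wpM2l; first exact: ltW.
  rewrite -subr_ge0 normCK (_ : _ - _ = `|v - m| ^+ 2) ?exprn_ge0 //.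
  by rewrite normCK rmorphB /=; ring.
have : \sum_(v <- rs) bisector_gap x z r * (v * m^* + v^* * m - m * m^*) <=
    \sum_(v <- rs) (v * (z - x) + (v * (z - x))^*).
  by rewrite !big_seq; apply: ler_sum => v /Kv'.
rewrite -mulr_sumr sumrB big_split /= -!mulr_suml -(rmorph_sum Num.conj) /=.
rewrite big_split /= -(rmorph_sum Num.conj) /= -!mulr_suml sum_rs -/m.
rewrite big_const_seq count_predT srs iter_addr_0 rmorphMn /=.
rewrite -!(mulr_natr m) -(mulr_natr m^*) !rmorphM rmorph_nat rmorphB /=.
set h := bisector_gap x z r => le_sum.
have : bisector_gap x z zeta * `|m| ^+ 2 <= 0.
  have -> : zeta = r + m^-1 by rewrite invrK subrKC.
  rewrite bisector_gapE // -/h subr_le0 normCK rmorphM rmorphB /=.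
  have N0 : 0 < n.+1%:R :> C by rewrite ltr0n.
  by rewrite -(ler_pM2r N0); apply: etrans le_sum; congr (_ <= _); ring.
by rewrite lt_geF // mulr_gt0 // exprn_gt0 // normr_gt0.
Qed.

(** The roots are released from the common point [s] one at a time by [walsh_step], each released
    factor being absorbed into [g]. When none is left, [s := x] applies, as [x] itself lies in the
    half-plane. *)
Lemma walsh_coincidence (C : numClosedFieldType) (Lam : {scalar {poly C}})
    (x z : C) (g : {poly C}) (rs : seq C) : x != z ->
    (forall s, 0 < bisector_gap x z s ->
       Lam (g * ('X - s%:P) ^+ size rs) != 0) ->
    (forall r, r \in rs -> 0 < bisector_gap x z r) ->
  Lam (g * \prod_(r <- rs) ('X - r%:P)) != 0.
Proof.
move=> xz; elim: rs g => [|zeta rs IH] g /= Hg Hrs.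
  rewrite big_nil -(expr0 ('X - x%:P)); apply: Hg.
  rewrite /bisector_gap subrr normr0 expr0n subr0 exprn_gt0 //.
  by rewrite normr_gt0 subr_eq0 eq_sym.
rewrite big_cons mulrA (mulrC g); apply: IH => [r hr|r rrs].
  by apply: (walsh_step Hg) => //; apply: Hrs; rewrite mem_head.
by apply: Hrs; rewrite in_cons rrs orbT.
Qed.

(* The integral over the segment from [x] to [z], for polynomials of size at
   most [N]. *)
Definition segment_integral (C : numClosedFieldType) (x z : C) (N : nat)
    (f : {poly C}) : C :=
  \sum_(i < N) f`_i * ((z ^+ i.+1 - x ^+ i.+1) / i.+1%:R).

Lemma segment_integral_is_scalar (C : numClosedFieldType) (x z : C) (N : nat) :
  scalar (segment_integral x z N).
Proof.
move=> a f g; rewrite /segment_integral mulr_sumr -big_split /=.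
by apply: eq_bigr => i _; rewrite coefD coefZ mulrDl mulrA.
Qed.

HB.instance Definition _ (C : numClosedFieldType) (x z : C) (N : nat) :=
  GRing.isLinear.Build C {poly C} C *%R
    (segment_integral x z N) (segment_integral_is_scalar x z N).

Lemma segment_integral_deriv (C : numClosedFieldType) (x z : C) (N : nat)
    (p : {poly C}) : (size p <= N.+1)%N ->
  segment_integral x z N p^`() = p.[z] - p.[x].
Proof.
move=> sp; rewrite !(horner_coef_wide _ sp) -sumrB big_ord_recl !expr0 subrr.
rewrite add0r; apply: eq_bigr => i _; rewrite coef_deriv /= -mulrBr.
by rewrite mulrnAl -mulrnAr -mulr_natr divfK ?pnatr_eq0.
Qed.

(** [P.[z] - P.[x]] is the integral of [P^]()[from]x[to]z[, a linear functional of]P^[()]. If all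
    critical points lie in the half-plane around [x], coincidence reduces the claim to [('X - s)^n],
    whose integral is nonzero because [|x - s| < |z - s|]. *)
Lemma grace_bisector (C : numClosedFieldType) (P : {poly C}) (x z : C) :
    x != z -> (1 < size P)%N ->
    (forall y, root P^`() y -> `|x - y| < `|z - y|) -> P.[x] != P.[z].
Proof.
move=> xz sP crit.
have [rs P'rs] := closed_field_poly_normal P^`().
have P'0 : P^`() != 0.
  apply: contraTneq sP => P'0; have := coef_deriv P (size P).-2.
  rewrite P'0 coef0; case sP2: (size P) => [|[|k]] //= /eqP.
  rewrite eq_sym mulrn_eq0 /= => /eqP e.
  by have := lead_coef_eq0 P; rewrite lead_coefE sP2 /= e eqxx -size_poly_eq0 sP2.
have lc0 : lead_coef P^`() != 0 by rewrite lead_coef_eq0.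
have gapE s : (0 < bisector_gap x z s) = (`|x - s| < `|z - s|).
  by rewrite subr_gt0 ltr_pXn2r // ?nnegrE.
have sP' : (size P^`()).-1 = size rs.
  by rewrite P'rs size_scale // size_prod_XsubC.
have srs : ((size rs).+1 < size P)%N.
  by rewrite -sP' prednK ?size_poly_gt0 // lt_size_deriv // -size_poly_gt0 ltnW.
rewrite eq_sym -subr_eq0 -(@segment_integral_deriv _ _ _ (size P)) //.
rewrite P'rs linearZ /= mulf_neq0 // -[\prod_(r <- rs) _]mul1r.
apply: (walsh_coincidence xz) => [s|r rrs]; last first.
  by rewrite gapE; apply: crit; rewrite P'rs rootZ // root_prod_XsubC.
rewrite gapE mul1r => lt_s; set n := size rs in srs *.
have sXn k : size (('X - s%:P) ^+ k) = k.+1 by rewrite size_exp_XsubC.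
have -> : ('X - s%:P) ^+ n = n.+1%:R^-1 *: (('X - s%:P) ^+ n.+1)^`().
  by rewrite deriv_exp derivXsubC mul1r -(scaler_nat _ (_ ^+ _)) scalerA mulVf ?scale1r ?pnatr_eq0.
rewrite linearZ /= mulf_neq0 ?invr_eq0 ?pnatr_eq0 //.
rewrite segment_integral_deriv ?sXn; last exact: ltnW.
rewrite !horner_exp !hornerXsubC subr_eq0.
apply: contraTneq lt_s => /(congr1 Num.norm); rewrite !normrX => /eqP.
by rewrite eqrXn2 // => /eqP ->; rewrite ltxx.
Qed.

(** * Real critical points *)

Lemma prod_XsubC_gt0 (R : realDomainType) (S : seq R) (x : R) :
  (forall s, s \in S -> s < x) -> 0 < (\prod_(s <- S) ('X - s%:P)).[x].
Proof.
move=> Sx; rewrite horner_prod big_seq; apply: prodr_gt0 => s /Sx.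
by rewrite hornerXsubC subr_gt0.
Qed.

Lemma prod_XsubC_sign (R : realDomainType) (S : seq R) (x : R) :
  (forall s, s \in S -> x < s) ->
  0 < (-1) ^+ size S * (\prod_(s <- S) ('X - s%:P)).[x].
Proof.
elim: S => [|s S IH] Sx; first by rewrite big_nil hornerC mulr1 ltr01.
rewrite big_cons hornerM hornerXsubC exprS mulrACA mulr_gt0 //.
  by rewrite mulN1r opprB subr_gt0 Sx // mem_head.
by apply: IH => t tS; apply: Sx; rewrite in_cons tS orbT.
Qed.

(** One critical point is taken in each gap between consecutive elements of the sorted [S]. That
    they avoid [S] and lie between elements of [S] lets further critical points be added to the list
    without repetition. *)
Lemma rolle_roots (R : rcfType) (P : {poly R}) (S : seq R) :
    S != [::] -> uniq S -> all (root P) S ->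
  exists rho, [/\ size rho = (size S).-1, uniq rho, all (root P^`()) rho &
    exists2 m, m \in S & forall r, r \in rho ->
      [/\ r \notin S, r < m & exists2 u, u \in S & u < r]].
Proof.
move=> S0 uS PS.
pose S1 := sort <=%R S.
have memS : S1 =i S by exact: mem_sort.
have sS : size S1 = size S by rewrite size_sort.
have ltS : sorted <%R S1 by rewrite sort_lt_sorted.
have PS1 : all (root P) S1 by rewrite all_sort.
have S10 : S1 != [::] by rewrite -size_eq0 sS size_eq0.
suff [rho [srho urho Prho [m mS Hm]]] : exists rho,
    [/\ size rho = (size S1).-1, uniq rho, all (root P^`()) rho &
    exists2 m, m \in S1 & forall r, r \in rho ->
      [/\ r \notin S1, r < m & exists2 u, u \in S1 & u < r]].
  exists rho; split; rewrite -?sS //; exists m; rewrite -?memS // => r /Hm.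
  by rewrite memS => -[? ? [u u1 ur]]; split => //; exists u; rewrite -?memS.
move: {S0 uS PS memS sS} S1 ltS PS1 S10 => [//|x s] xs Pxs _.
have : exists rho, [/\ size rho = size s, uniq rho, all (root P^`()) rho &
    forall r, r \in rho -> [/\ r \notin x :: s, r < last x s & x < r]].
  elim: s x xs Pxs => [|y s IH] x /=; first by exists [::].
  move=> /andP[xy ys] /andP[Px Pys].
  have [rho [srho urho Prho Hrho]] := IH y ys Pys.
  have [|c] := rolle xy (p := P).
    by move: Pys => /= /andP[/rootP -> _]; apply/rootP.
  rewrite in_itv /= => /andP[xc cy] P'c.
  have yS t : t \in y :: s -> y <= t.
    rewrite in_cons => /orP[/eqP -> //|ts]; apply: ltW.
    by move: ys; rewrite (path_sortedE lt_trans) => /andP[/allP /(_ _ ts)].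
  exists (c :: rho); split=> /=; first by rewrite srho.
  - by rewrite urho andbT; apply/negP => /Hrho [_ _]; rewrite ltNge ltW.
  - by rewrite Prho andbT; apply/rootP.
  move=> r; rewrite in_cons => /orP[/eqP -> {r}|/Hrho [rS rl yr]].
    split=> //; last by rewrite (lt_le_trans cy) // yS // mem_last.
    rewrite in_cons negb_or gt_eqF //=; apply/negP => /yS.
    by rewrite leNgt cy.
  have xr : x < r by exact: lt_trans yr.
  by split=> //; rewrite in_cons negb_or gt_eqF.
move=> [rho [srho urho Prho Hrho]]; exists rho; split=> //.
exists (last x s); first exact: mem_last.
by move=> r /Hrho [? ? ?]; split=> //; exists x; rewrite ?mem_head.
Qed.

Lemma poly_const_sign (R : rcfType) (P : {poly R}) (c d : R) : c <= d ->
    (forall x, c < x < d -> ~~ root P x) ->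
  exists j : nat, forall x, c <= x <= d -> 0 <= (-1) ^+ j * P.[x].
Proof.
move=> cd noroot.
have noroot2 x y : c <= x <= d -> c <= y <= d -> P.[x] * P.[y] < 0 -> False.
  wlog xy : x y / x <= y => [hw|] hx hy Pxy.
    by case: (leP x y) => [/hw|/ltW /hw]; apply=> //; rewrite mulrC.
  have [u] := poly_ivtoo xy Pxy; rewrite in_itv /= => hu; apply/negP/noroot.
  by lra.
pose m := (c + d) / 2%:R.
have hm : c <= m <= d by rewrite /m; lra.
(* The boolean [P.[m] < 0], coerced to [nat], is the exponent. If [c = d], the midpoint may be a
   root, so that case stands apart. *)
have [cd'|dc] := ltP c d; last first.
  exists (P.[m] < 0)%R => x hx; have -> : x = m by rewrite /m; lra.
  by case: ltP => h; rewrite ?expr0 ?expr1; lra.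
have Pm : P.[m] != 0 by apply: noroot; rewrite /m; lra.
exists (P.[m] < 0)%R => x hx; rewrite leNgt; apply/negP => Px.
apply: (noroot2 x m hx hm); move: Px Pm.
by case: (ltgtP P.[m] 0) => //= h; rewrite ?expr0 ?expr1 => Px _; nra.
Qed.

(** [S] collects the zeros of odd order in the open interval. Roots are peeled off by induction on
    the degree: a root already in [S] leaves [S], and the resulting square goes into [P1] without
    affecting its sign. *)
Lemma sign_change_decomposition (R : rcfType) (c d : R) (P : {poly R}) :
    c <= d -> P != 0 ->
  exists (S : seq R) (P1 : {poly R}) (j : nat),
    [/\ uniq S, forall s, s \in S -> c < s < d,
        P = \prod_(s <- S) ('X - s%:P) * P1 &
        forall x, c <= x <= d -> 0 <= (-1) ^+ j * P1.[x]].
Proof.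
move=> cd; have [N] := ubnP (size P); elim: N P => // N IH P sP P0.
case rP: (roots P c d) => [|s r].
  have [|j Hj] := @poly_const_sign R P c d cd.
    move=> x hx; apply/negP => Px; suff : x \in roots P c d by rewrite rP.
    by rewrite in_roots Px P0 in_itv /= hx.
  by exists [::], P, j; split=> //; rewrite big_nil mul1r.
have : s \in roots P c d by rewrite rP mem_head.
rewrite in_roots in_itv /= => /and3P[/factor_theorem[q Pq] hs _].
have q0 : q != 0 by apply: contraNneq P0 => q0; rewrite Pq q0 mul0r.
have sq : (size q < N)%N.
  by move: sP; rewrite Pq size_Mmonic ?monicXsubC // size_XsubC addn2.
have [S [q1 [j [uS hS qE q1s]]]] := IH q sq q0.
have [sS|sS] := boolP (s \in S); last first.
  exists (s :: S), q1, j; split=> //=; first by rewrite sS.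
    by move=> t; rewrite in_cons => /orP[/eqP ->|/hS].
  by rewrite big_cons Pq {1}qE; ring.
exists (rem s S), (('X - s%:P) ^+ 2 * q1), j; split.
- exact: rem_uniq.
- by move=> t /mem_rem /hS.
- by rewrite Pq {1}qE (big_rem s) //=; ring.
by move=> x /q1s h; rewrite hornerM horner_exp hornerXsubC mulrCA mulr_ge0 // sqr_ge0.
Qed.

(** These are [size S + size T] homogeneous linear conditions on one more coefficient. *)
Lemma hermite_kernel (F : fieldType) (S T : seq F) :
  exists Q : {poly F}, [/\ Q != 0, (size Q <= (size S + size T).+1)%N,
    all (root Q) S & all (root Q^`()) T].
Proof.
pose k := size S; pose m := size T.
(* The entries are the values at [S] and the derivatives at [T] of ['X^i]. At [i = 0] the exponent
   [i.-1] is a dummy, as [*+ i] makes the entry 0. *)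
pose A : 'M[F]_((k + m).+1, k + m) := row_mx
  (\matrix_(i < (k + m).+1, j < k) S`_j ^+ i)
  (\matrix_(i < (k + m).+1, j < m) (T`_j ^+ i.-1 *+ i)).
have : kermx A != 0.
  rewrite kermx_eq0 /row_free neq_ltn; apply/orP; left.
  by rewrite ltnS rank_leq_col.
move=> /rowV0Pn [v /sub_kermxP vA v0].
have vA1 : v *m (\matrix_(i < (k + m).+1, j < k) S`_j ^+ i) = 0.
  by move: vA; rewrite mul_mx_row -row_mx0 => /eq_row_mx [].
have vA2 : v *m (\matrix_(i < (k + m).+1, j < m) (T`_j ^+ i.-1 *+ i)) = 0.
  by move: vA; rewrite mul_mx_row -row_mx0 => /eq_row_mx [].
have Q0 : rVpoly v != 0.
  by apply: contraNneq v0 => Q0; rewrite -(rVpolyK v) Q0 linear0.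
exists (rVpoly v); split=> //.
- exact: size_poly.
- apply/(all_nthP 0) => i ik; apply/rootP.
  rewrite (horner_coef_wide _ (size_poly _ _)).
  move/matrixP: vA1 => /(_ 0 (Ordinal ik)); rewrite !mxE => vA0; rewrite -[RHS]vA0.
  by apply: eq_bigr => j _; rewrite mxE coef_rVpoly_ord.
apply/(all_nthP 0) => i im; apply/rootP.
have sQ' : (size (rVpoly v)^`() <= k + m)%N.
  by rewrite -ltnS (leq_trans (lt_size_deriv Q0)) // size_poly.
rewrite (horner_coef_wide _ sQ').
move/matrixP: vA2 => /(_ 0 (Ordinal im)).
rewrite !mxE big_ord_recl !mxE mulr0n mulr0 add0r => vA0.
rewrite -[RHS]vA0; apply: eq_bigr => j _; rewrite mxE coef_deriv -(coef_rVpoly_ord v).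
by rewrite mulrnAl mulrnAr.
Qed.

Lemma sign_right_of_root (R : rcfType) (P E : {poly R}) (rho T : seq R)
    (e m b : R) : root P m -> m < b -> (forall r, r \in rho -> r < m) ->
    (forall t, t \in T -> b <= t) ->
    P^`() = \prod_(r <- rho) ('X - r%:P) * \prod_(t <- T) ('X - t%:P) * E ->
    (forall x, m < x < b -> 0 < e * E.[x]) ->
  0 < e * (-1) ^+ size T * P.[b].
Proof.
move=> /rootP Pm mb rhom Tb P'E Ee.
have [x] := mvt P mb; rewrite in_itv /= Pm subr0 => xmb ->.
rewrite P'E !hornerM mulrA mulr_gt0 ?subr_gt0 //.
rewrite [X in 0 < X](_ : _ = (\prod_(r <- rho) ('X - r%:P)).[x] *
  ((-1) ^+ size T * (\prod_(t <- T) ('X - t%:P)).[x]) * (e * E.[x])); last by ring.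
case/andP: (xmb) => mx xb.
apply: mulr_gt0; last exact: Ee.
apply: mulr_gt0.
  by apply: prod_XsubC_gt0 => r /rhom /lt_trans; apply.
by apply: prod_XsubC_sign => t /Tb; apply: lt_le_trans.
Qed.

Lemma uniq_cat_lt (R : realDomainType) (b : R) (S T : seq R) :
    uniq S -> uniq T -> (forall s, s \in S -> s < b) ->
    (forall t, t \in T -> b <= t) -> uniq (S ++ T).
Proof.
move=> uS uT Sb Tb; rewrite cat_uniq uS uT andbT /=; apply/hasPn => t /Tb bt.
by apply/negP => /Sb; rewrite ltNge bt.
Qed.

Lemma root_deriv_sqr (R : comNzRingType) (q : {poly R}) (u : R) :
  root (q * ('X - u%:P) ^+ 2)^`() u.
Proof.
apply/rootP; rewrite derivM expr2 derivM derivXsubC.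
by rewrite !(hornerXsubC, hornerM, hornerD) subrr !(mulr0, mul0r, addr0).
Qed.

(** [Q] is a Hermite interpolant, scaled so that [Q^]()[is monic. Rolle's theorem gives]size S -
    1[critical points besides]T[, which exhausts the degree of]Q^[()]. Hence [Q2] is the product
    over Rolle's points, all left of [b], and a root of [Q1] at or left of [b] would create one
    critical point too many. *)
Lemma comparison_poly (R : rcfType) (b : R) (S T : seq R) :
    S != [::] -> uniq S -> uniq T -> (forall s, s \in S -> s < b) ->
    (forall t, t \in T -> b <= t) ->
  exists Q Q1 Q2 : {poly R},
    [/\ (size Q <= (size S + size T).+1)%N,
        Q = \prod_(s <- S) ('X - s%:P) * Q1,
        Q^`() = \prod_(t <- T) ('X - t%:P) * Q2,
        forall x, x <= b -> 0 < (-1) ^+ size T * Q1.[x] &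
        forall x, b <= x -> 0 < Q2.[x]].
Proof.
move=> S0 uS uT Sb Tb.
have [Q [Q0 sQ QS Q'T]] := hermite_kernel S T.
have S1 : (0 < size S)%N by rewrite lt0n size_eq0.
have Q'0 : Q^`() != 0.
  apply: contraNneq Q0 => Q'0; have := polyorder.size_deriv Q.
  rewrite Q'0 size_poly0; case sQ1 : (size Q) => [|[|]] // _.
    by rewrite -size_poly_eq0 sQ1.
  have /size1_polyC QE : (size Q <= 1)%N by rewrite sQ1.
  case: (S) S0 QS => //= s S' _ /andP[]; rewrite QE rootC => /eqP -> _.
  by rewrite polyC0.
have sQ' : (size Q^`() <= size S + size T)%N.
  by rewrite polyorder.size_deriv; move: sQ; case: (size Q).
have [rho [srho urho Q'rho [m mS Hm]]] := rolle_roots S0 uS QS.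
have rhob r : r \in rho -> r < b by move=> /Hm[_ /lt_trans + _]; apply; apply: Sb.
have Q'rT : all (root Q^`()) (rho ++ T) by rewrite all_cat Q'rho.
have urT : uniq (rho ++ T) by exact: (uniq_cat_lt (b := b)).
have srT : size Q^`() = (size (rho ++ T)).+1.
  apply/eqP; rewrite eqn_leq max_poly_roots // andbT size_cat srho -addSn prednK //.
have [c0 Q'E] : lead_coef Q^`() != 0 /\
    Q^`() = lead_coef Q^`() *: \prod_(r <- rho ++ T) ('X - r%:P).
  by rewrite lead_coef_eq0; split=> //;
    apply: all_roots_prod_XsubC => //; rewrite uniq_rootsE.
set c := lead_coef _ in c0 Q'E.
have rootcQ u : root (c^-1 *: Q) u = root Q u by rewrite rootZ ?invr_eq0.
have rootcQ' u : root (c^-1 *: Q^`()) u = root Q^`() u.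
  by rewrite rootZ ?invr_eq0.
have /dvdpP[Q1 QE] : \prod_(s <- S) ('X - s%:P) %| c^-1 *: Q.
  by apply: uniq_roots_dvdp; rewrite ?uniq_rootsE // (eq_all rootcQ).
have Q'E1 : (c^-1 *: Q)^`() =
    \prod_(r <- rho) ('X - r%:P) * \prod_(t <- T) ('X - t%:P) * 1.
  by rewrite derivZ Q'E scalerA mulVf // scale1r big_cat mulr1.
exists (c^-1 *: Q), Q1, (\prod_(r <- rho) ('X - r%:P)); split.
- by rewrite size_scale ?invr_eq0.
- by rewrite QE mulrC.
- by rewrite Q'E1 mulr1 mulrC.
- have Q1root u : u <= b -> ~~ root Q1 u.
    move=> ub; apply/negP => Q1u.
    (* [T] already takes [size T] of the critical points, leaving fewer than [size S] to the left of
       [b]. *)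
    have toomany us : uniq us -> (forall u, u \in us -> u < b) ->
        all (root Q^`()) us -> (size us < size S)%N.
      move=> uus usb rus; have uusT := uniq_cat_lt uus uT usb Tb.
      have := max_poly_roots Q'0 _ uusT; rewrite all_cat rus Q'T => /(_ isT).
      by rewrite size_cat => /leq_trans /(_ sQ'); rewrite ltn_add2r.
    have Qu : root Q u.
      by rewrite -rootcQ QE rootM Q1u.
    have [uS'|uS'] := boolP (u \in S).
      (* If [u] is in [S] it is a double root of [Q], hence a critical point, and it is new because
         [rho] avoids [S]. *)
      suff : (size (u :: rho) < size S)%N by rewrite /= srho prednK // ltnn.
      apply: toomany.
      - by rewrite /= urho andbT; apply/negP => /Hm[]; rewrite uS'.
      - by move=> v; rewrite in_cons => /orP[/eqP -> |/rhob //]; exact: Sb.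
      rewrite /= Q'rho andbT.
      have /factor_theorem[q qE] := Q1u.
      rewrite -rootcQ' -derivZ QE qE.
      have -> : \prod_(s <- S) ('X - s%:P) =
          ('X - u%:P) * \prod_(s <- rem u S) ('X - s%:P) by rewrite (big_rem u).
      rewrite mulrA -(mulrA q) -expr2 mulrAC.
      exact: root_deriv_sqr.
    have uS2 : uniq (u :: S) by rewrite /= uS'.
    have QuS : all (root Q) (u :: S) by rewrite /= Qu.
    have [rho' [srho' urho' Q'rho' [m' m'S Hm']]] :=
      @rolle_roots _ Q (u :: S) isT uS2 QuS.
    suff : (size rho' < size S)%N by rewrite srho' /= ltnn.
    apply: toomany => // v /Hm'[_ vm _]; apply: lt_le_trans vm _.
    move: m'S; rewrite in_cons => /orP[/eqP ->//|/Sb /ltW //].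
  have Q1b : 0 < (-1) ^+ size T * Q1.[b].
    have := @sign_right_of_root _ (c^-1 *: Q) 1 rho T 1 m b.
    rewrite rootcQ (allP QS) // Sb // => /(_ isT isT) H.
    have {H} : 0 < 1 * (-1) ^+ size T * (c^-1 *: Q).[b].
      by apply: H => // [r /Hm[]|x _] //; rewrite hornerC mulr1.
    by rewrite mul1r QE hornerM mulrA pmulr_lgt0 // prod_XsubC_gt0.
  (* A change of sign of [Q1] between [x] and [b] would produce a forbidden root. *)
  move=> x xb; rewrite ltNge; apply/negP => Q1x.
  have Q1xb : Q1.[x] * Q1.[b] <= 0.
    rewrite -[_ * _]mul1r -(sqrr_sign R (size T)) expr2 mulrACA.
    exact: mulr_le0_ge0 Q1x (ltW Q1b).
  have [u] := polyrcf.poly_ivt xb Q1xb.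
  by rewrite in_itv /= => /andP[_ /Q1root /negP].
move=> x bx; apply: prod_XsubC_gt0 => r /rhob rb; exact: lt_le_trans bx.
Qed.

Lemma signr_or (R : nzRingType) (i j : nat) :
  (-1) ^+ i = (-1) ^+ j :> R \/ (-1) ^+ i = (-1) ^+ j.+1 :> R.
Proof.
rewrite -(signr_odd R i) -(signr_odd R j) -(signr_odd R j.+1) /=.
by case: (odd i); case: (odd j); [left|right|right|left].
Qed.

(* The norm of [L - t Q] has nonpositive derivative at [t = 0] in the directions
   [Q] excluded here. *)
Definition no_descent_direction (R : rcfType) (a b c d : R) (n : nat)
    (L : {poly R}) : Prop :=
  forall Q : {poly R}, Q != 0 -> (size Q <= n)%N ->
    (forall x, a <= x <= b -> 0 <= L.[x] * Q.[x]) ->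
    (forall x, c <= x <= d -> 0 <= L^`().[x] * Q^`().[x]) -> False.

Lemma real_critical_points (R : rcfType) (a b c d : R) (n : nat) (L : {poly R}) :
    b <= c -> a < b -> c <= d -> (0 < n)%N -> size L = n.+1 ->
    no_descent_direction a b c d n L ->
  exists x0 ys, [/\ a < x0 < b, root L x0,
    L^`() = lead_coef L^`() *: \prod_(y <- ys) ('X - y%:P) &
    forall y, y \in ys -> a <= y <= d].
Proof.
move=> bc ab cd n0 sL nodescent.
have L0 : L != 0 by rewrite -size_poly_eq0 sL.
have sL' : size L^`() = n by rewrite polyorder.size_deriv sL.
have L'0 : L^`() != 0 by rewrite -size_poly_eq0 sL' -lt0n.
have [S [L1 [j [uS hS LE L1s]]]] := sign_change_decomposition (ltW ab) L0.
have [T [M1 [i [uT hT L'E M1s]]]] := sign_change_decomposition cd L'0.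
have Sb s : s \in S -> s < b by case/hS/andP.
have Tc t : t \in T -> c < t by case/hT/andP.
have Tb t : t \in T -> b <= t by move=> /Tc /ltW; apply: le_trans.
(* If [L] did not change sign on [(a, b)], the constant of the same sign would be an excluded
   direction. *)
have S0 : S != [::].
  apply/eqP => S0; apply: (nodescent ((-1) ^+ j)%:P).
  - by rewrite polyC_eq0 signr_eq0.
  - by rewrite (leq_trans (size_polyC_leq1 _)).
  - by move=> x /L1s; rewrite LE S0 big_nil mul1r hornerC mulrC.
  by move=> x _; rewrite derivC hornerC mulr0.
have S1 : (0 < size S)%N by rewrite lt0n size_eq0.
have LS : all (root L) S.
  by apply/allP => s sS; rewrite LE rootM root_prod_XsubC sS.
have L'T : all (root L^`()) T.
  by apply/allP => t tT; rewrite L'E rootM root_prod_XsubC tT.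
have [rho [srho urho L'rho [m mS Hm]]] := rolle_roots S0 uS LS.
have rhob r : r \in rho -> r < b by move=> /Hm[_ /lt_trans + _]; apply; apply: Sb.
have rhoa r : r \in rho -> a < r.
  by move=> /Hm[_ _ [u /hS /andP[au _]]]; apply: lt_trans.
have L'rT : all (root L^`()) (rho ++ T) by rewrite all_cat L'rho.
have urT : uniq (rho ++ T) by exact: (uniq_cat_lt (b := b)).
have rTad y : y \in rho ++ T -> a <= y <= d.
  rewrite mem_cat => /orP[yr|/hT /andP[cy yd]].
    by rewrite ltW ?rhoa //= (le_trans (ltW (rhob _ yr))) // (le_trans bc).
  by rewrite (ltW yd) andbT (le_trans (ltW ab)) // (le_trans bc) // ltW.
have skl : (size S + size T <= n)%N.
  have := max_poly_roots L'0 L'rT urT.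
  by rewrite size_cat srho sL'; case: (size S) S1.
have contra T' : uniq T' -> (forall t, t \in T' -> b <= t) ->
    (size S + size T' < n)%N ->
    (forall x, c <= x <= d -> 0 <= (-1) ^+ (j + size T') *
       (L^`() * \prod_(t <- T') ('X - t%:P)).[x]) -> False.
  move=> uT' T'b sT' L'T'.
  have [Q [Q1 [Q2 [sQ QE Q'E Q1s Q2s]]]] := comparison_poly S0 uS uT' Sb T'b.
  apply: (nodescent ((-1) ^+ (j + size T') *: Q)).
  - rewrite scaler_eq0 signr_eq0 /= QE mulf_neq0 //.
      by rewrite monic_neq0 // monic_prod_XsubC.
    by apply: contraTneq (Q1s _ (lexx b)) => ->; rewrite hornerC mulr0 ltxx.
  - by rewrite size_scale ?signr_eq0 // (leq_trans sQ).
  - move=> x xab; have L1x := L1s _ xab; case/andP: xab => _ /Q1s /ltW Q1x.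
    rewrite hornerZ LE QE !hornerM exprD.
    set W := (\prod_(s <- S) _).[x].
    rewrite [X in 0 <= X](_ : _ = W ^+ 2 * ((-1) ^+ j * L1.[x]) *
      ((-1) ^+ size T' * Q1.[x])); last by ring.
    by rewrite mulr_ge0 // mulr_ge0 // sqr_ge0.
  move=> x xcd; have := L'T' x xcd; case/andP: (xcd) => cx _.
  have /ltW Q2x := Q2s x (le_trans bc cx).
  rewrite derivZ hornerZ Q'E !hornerM mulrCA !mulrA => h.
  by apply: mulr_ge0 => //; rewrite -!mulrA mulrCA mulrA in h *.
exists m; case: (ltngtP (size S + size T) n) skl => // [skl _|skl _]; last first.
  exists (rho ++ T); split=> //; [exact: hS|exact: (allP LS)|].
  apply: all_roots_prod_XsubC => //; last by rewrite uniq_rootsE.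
  by rewrite sL' size_cat srho -addSn prednK.
case: (ltngtP (size S + size T).+1 n) (skl) => // [skl2 _|skl2 _].
  (* If the parity is wrong, the extra node [b] flips the sign of the direction, while its factor
     [x - b] stays nonnegative on [[c, d]]. *)
  exfalso; have [e|e] := signr_or R i (j + size T).
    apply: (contra T) => // x xcd; rewrite -e L'E !hornerM.
    have := M1s x xcd; set V := (\prod_(t <- T) _).[x] => h.
    rewrite [X in 0 <= X](_ : _ = V ^+ 2 * ((-1) ^+ i * M1.[x])); last by ring.
    by rewrite mulr_ge0 // sqr_ge0.
  apply: (contra (b :: T)) => /=.
  - rewrite uT andbT; apply/negP => /Tc; apply/negP; rewrite -leNgt //.
  - by move=> t; rewrite in_cons => /orP[/eqP ->|/Tb].
  - by rewrite addnS.
  move=> x xcd; rewrite addnS -e L'E big_cons !hornerM hornerXsubC.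
  have := M1s x xcd; set V := (\prod_(t <- T) _).[x] => h.
  rewrite [X in 0 <= X](_ : _ = V ^+ 2 * (x - b) * ((-1) ^+ i * M1.[x])); last by ring.
  case/andP: xcd => cx _.
  by rewrite mulr_ge0 // mulr_ge0 ?sqr_ge0 // subr_ge0 (le_trans bc).
(* Exactly one critical point is missing: the cofactor [E] is linear and its root [y] is real. *)
have /dvdpP[E EE] : \prod_(r <- rho ++ T) ('X - r%:P) %| L^`().
  by apply: uniq_roots_dvdp; rewrite ?uniq_rootsE.
have srT : (size (rho ++ T)).+2 = n.
  by rewrite size_cat srho -addSn prednK.
have E0 : E != 0 by apply: contraNneq L'0 => E0; rewrite EE E0 mul0r.
have sE : size E = 2.
  move: sL'; rewrite EE size_Mmonic ?monic_prod_XsubC // size_prod_XsubC -srT.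
  by rewrite addnS /= -[in X in _ = X -> _]add2n => /addIn.
have [y Ey] : exists y, root E y.
  exists (- (E`_0 / E`_1)); apply/rootP.
  have E1 : E`_1 != 0.
    by have := lead_coef_eq0 E; rewrite lead_coefE sE (negbTE E0) => ->.
  rewrite horner_coef sE !big_ord_recl big_ord0 /=.
  by field.
have [yad|yad] := boolP (a <= y <= d).
  exists (y :: rho ++ T); split; [exact: hS|exact: (allP LS)| |]; last first.
    by move=> u; rewrite in_cons => /orP[/eqP ->|/rTad].
  have EL : E = lead_coef E *: ('X - y%:P).
    have := @all_roots_prod_XsubC _ E [:: y]; rewrite big_seq1 sE /= Ey.
    by apply.
  rewrite EE lead_coefM (eqP (monic_prod_XsubC _ _ _)) mulr1 {1}EL big_cons.
  by rewrite scalerAl.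
exfalso.
have Enz x : a <= x <= d -> ~~ root E x.
  move=> xad; apply/negP => Ex; have := max_poly_roots E0 (rs := [:: x; y]).
  rewrite /= Ex Ey sE ltnn !andbT inE => /(_ isT) H.
  by suff : false by []; apply: H; apply: contraNneq yad => <-.
have [||e Ee] := @poly_const_sign _ E a d.
- by rewrite (le_trans (ltW ab)) // (le_trans bc).
- by move=> x /andP[ax xd]; apply: Enz; rewrite !ltW.
have Ee' x : a <= x <= d -> 0 < (-1) ^+ e * E.[x].
  by move=> xad; rewrite lt_def Ee // andbT mulf_eq0 signr_eq0 Enz.
have L'EE : L^`() = \prod_(r <- rho) ('X - r%:P) * \prod_(t <- T) ('X - t%:P) * E.
  by rewrite EE big_cat mulrC.
have Lb : 0 < (-1) ^+ e * (-1) ^+ size T * L.[b].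
  have := @sign_right_of_root _ L E rho T ((-1) ^+ e) m b.
  apply=> //; [exact: (allP LS)|exact: Sb|by move=> r /Hm[]|].
  move=> x /andP[mx xb]; apply: Ee'; case/andP: (hS _ mS) => am _.
  by rewrite (ltW (lt_trans am mx)) (le_trans (ltW xb)) // (le_trans bc).
(* The sign of [L] at [b], read once from its factorisation over [S] and once from [Lb], ties [j] to
   the constant sign [e] of [E] on [[a, d]]; this is the parity that makes [T] itself admissible. *)
have je : (-1) ^+ j = (-1) ^+ (e + size T) :> R.
  have [//|je] := signr_or R j (e + size T).
  have := L1s b; rewrite lexx ltW // => /(_ isT); rewrite je exprS mulN1r mulNr.
  rewrite oppr_ge0 leNgt exprD; move: Lb; rewrite LE hornerM.
  have Wb : 0 < (\prod_(s <- S) ('X - s%:P)).[b] by apply: prod_XsubC_gt0.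
  by rewrite mulrCA pmulr_rgt0 // => ->.
apply: (contra T) => //.
move=> x /andP[cx xd].
rewrite exprD je exprD -[_ * _ * _ in X in X * _]mulrA -expr2 sqrr_sign mulr1.
rewrite L'EE !hornerM; set V := (\prod_(t <- T) _).[x].
have rx : 0 < (\prod_(r <- rho) ('X - r%:P)).[x].
  by apply: prod_XsubC_gt0 => r /rhob /lt_le_trans; apply; rewrite (le_trans bc).
have Ex : 0 < (-1) ^+ e * E.[x].
  by apply: Ee'; rewrite xd andbT (le_trans (ltW ab)) // (le_trans bc).
set U := (\prod_(r <- rho) _).[x] in rx *.
rewrite [X in 0 <= X](_ : _ = V ^+ 2 * U * ((-1) ^+ e * E.[x])); last by ring.
by apply: mulr_ge0 (ltW Ex); apply: mulr_ge0 (ltW rx); exact: sqr_ge0.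
Qed.

(** * Perturbation of the extremal polynomial *)

(** For [p >= 1] a factor [q] in [(0, 1]] satisfies [(q x)^p <= q x^p]. With [q = (x - h) / x],
    lowering [x] by [h] gains at least [h x^p / x], a bound linear in [h]. *)
Lemma powR_gain (R : realType) (p x y h del M : R) : 1 <= p -> 0 <= h ->
    0 <= y -> y <= x - h -> 0 < del -> del <= x -> x <= M ->
  y `^ p + h * del `^ p / M <= x `^ p.
Proof.
move=> p1 h0 y0 yx del0 delx xM.
have x0 : 0 < x by lra.
have M0 : 0 < M by lra.
have p0 : 0 <= p by lra.
have le1 : y `^ p <= (x - h) / x * x `^ p.
  (* The scaling inequality needs a positive factor, so [h = x] is treated apart. *)
  have [hx|xh] := eqVneq h x.
    have -> : y = 0 by lra.
    by rewrite hx subrr mul0r mul0r powR0 // gt_eqF //; lra.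
  apply: (@le_trans _ _ (((x - h) / x * x) `^ p)).
    rewrite divfK ?gt_eqF //; apply: ge0_ler_powR => //; rewrite nnegrE; lra.
  apply: ge1r_powRZ => //; last exact: ltW.
  have xh0 : 0 < x - h by rewrite subr_gt0 lt_neqAle xh /=; lra.
  by rewrite divr_gt0 //= ler_pdivrMr // mul1r; lra.
have le2 : h * del `^ p / M <= h * x `^ p / x.
  rewrite -!mulrA; apply: ler_wpM2l => //; apply: ler_pM.
  - exact: powR_ge0.
  - by rewrite invr_ge0 ltW.
  - by apply: ge0_ler_powR => //; rewrite nnegrE ltW.
  by rewrite lef_pV2 // posrE.
have -> : x `^ p = (x - h) / x * x `^ p + h * x `^ p / x.
  by field; rewrite gt_eqF.
exact: lerD.
Qed.

(** [g0, g1] belong to the extremal polynomial and [f0, f1] to a competitor that gains [k] on [E]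
    and loses at most [K] elsewhere. Integrating the pointwise bounds and cancelling the integrals
    gives the claim. *)
Lemma energy_gap (R : realType) (disp : measure_display)
    (X : measurableType disp) (mu0 mu1 : {finite_measure set X -> \bar R})
    (D0 D1 E : set X) (f0 f1 g0 g1 : X -> R) (N k K : R) :
    measurable D0 -> measurable D1 -> measurable E -> E `<=` D0 ->
    measurable_fun setT f0 -> measurable_fun setT f1 ->
    measurable_fun setT g0 -> measurable_fun setT g1 ->
    (forall x, 0 <= f0 x) -> (forall x, 0 <= f1 x) ->
    (forall x, 0 <= g0 x) -> (forall x, 0 <= g1 x) ->
    (forall x, D0 x -> f0 x <= N) -> (forall x, D1 x -> f1 x <= N) ->
    0 <= k -> 0 <= K ->
    (forall x, D0 x -> f0 x + k * \1_E x <= g0 x + K) ->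
    (forall x, D1 x -> f1 x <= g1 x + K) ->
    (\int[mu0]_(x in D0) (g0 x)%:E + \int[mu1]_(x in D1) (g1 x)%:E <=
     \int[mu0]_(x in D0) (f0 x)%:E + \int[mu1]_(x in D1) (f1 x)%:E)%E ->
  k * fine (mu0 E) <= K * (fine (mu0 D0) + fine (mu1 D1)).
Proof.
move=> mD0 mD1 mE ED0 mf0 mf1 mg0 mg1 f0p f1p g0p g1p f0N f1N k0 K0 le0 le1 leI.
have mE_ (D : set X) (f : X -> R) :
    measurable_fun setT f -> measurable_fun D (EFin \o f).
  by move=> mf; apply/measurable_EFinP; apply: measurable_funTS.
have finI (mu : {finite_measure set X -> \bar R}) (D : set X) (f : X -> R) :
    measurable D -> measurable_fun setT f -> (forall x, 0 <= f x) ->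
    (forall x, D x -> f x <= N) ->
    (\int[mu]_(x in D) (f x)%:E)%E \is a fin_num.
  move=> mD mf fp fN; rewrite ge0_fin_numE; last first.
    by apply: integral_ge0 => x _; rewrite lee_fin.
  apply: (@le_lt_trans _ _ (\int[mu]_(x in D) (cst N%:E x))%E).
    by apply: ge0_le_integral => //; [by move=> x _; rewrite lee_fin|exact: mE_].
  rewrite integral_cst // ltey_eq fin_numM // fin_num_measure //.
have I0 : (\int[mu0]_(x in D0) (f0 x)%:E + k%:E * mu0 E <=
           \int[mu0]_(x in D0) (g0 x)%:E + K%:E * mu0 D0)%E.
  have <- : (\int[mu0]_(x in D0) (k * \1_E x)%:E = k%:E * mu0 E)%E.
    under eq_integral do rewrite EFinM.
    rewrite ge0_integralZl_EFin //; last by apply: mE_; exact: measurable_indic.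
    by rewrite integral_indic // setIidl.
  rewrite -(integral_cst mu0 mD0) -!ge0_integralD //.
  all: try by move=> x _; rewrite lee_fin // mulr_ge0.
  all: try exact: mE_.
  - apply: ge0_le_integral => //.
    + by move=> x _; rewrite -EFinD lee_fin addr_ge0 // mulr_ge0.
    + apply: emeasurable_funD; apply: mE_ => //.
      by apply: measurable_funM => //; exact: measurable_indic.
    + by apply: emeasurable_funD => //; apply: mE_.
  by apply: mE_; apply: measurable_funM => //; exact: measurable_indic.
have I1 : (\int[mu1]_(x in D1) (f1 x)%:E <=
           \int[mu1]_(x in D1) (g1 x)%:E + K%:E * mu1 D1)%E.
  rewrite -(integral_cst mu1 mD1) -ge0_integralD //.
  - apply: ge0_le_integral => //.
    + by move=> x _; rewrite lee_fin.
    + exact: mE_.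
    + by apply: emeasurable_funD => //; apply: mE_.
  - by move=> x _; rewrite lee_fin.
  - exact: mE_.
have If0 := finI mu0 _ _ mD0 mf0 f0p f0N.
have If1 := finI mu1 _ _ mD1 mf1 f1p f1N.
have Ig0p : (0 <= \int[mu0]_(x in D0) (g0 x)%:E)%E.
  by apply: integral_ge0 => x _; rewrite lee_fin.
have Ig1p : (0 <= \int[mu1]_(x in D1) (g1 x)%:E)%E.
  by apply: integral_ge0 => x _; rewrite lee_fin.
(* No bound on [g0, g1] is assumed: their integrals are finite because [leI] bounds them by those of
   [f0, f1]. *)
have ltoo : (\int[mu0]_(x in D0) (g0 x)%:E + \int[mu1]_(x in D1) (g1 x)%:E < +oo)%E.
  by apply: le_lt_trans leI _; rewrite ltey_eq fin_numD If0 If1.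
have Ig0 : (\int[mu0]_(x in D0) (g0 x)%:E)%E \is a fin_num.
  by rewrite ge0_fin_numE //; apply: le_lt_trans ltoo; rewrite leeDl.
have Ig1 : (\int[mu1]_(x in D1) (g1 x)%:E)%E \is a fin_num.
  by rewrite ge0_fin_numE //; apply: le_lt_trans ltoo; rewrite leeDr.
have fE := fin_num_measure mu0 _ mE.
have fD0 := fin_num_measure mu0 _ mD0.
have fD1 := fin_num_measure mu1 _ mD1.
move: I0 I1 leI; rewrite -(fineK fE) -(fineK fD0) -(fineK fD1).
rewrite -(fineK If0) -(fineK If1) -(fineK Ig0) -(fineK Ig1).
rewrite -!EFinM -!EFinD !lee_fin; lra.
Qed.

(** * Complex polynomials on the real line as pairs of real polynomials *)

Definition rcpoly (R : realType) (A B : {poly R}) : {poly R[i]} :=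
  map_poly (real_complex R) A +
  (Complex 0 1 : R[i]) *: map_poly (real_complex R) B.

Definition modulus (R : realType) (A B : {poly R}) (x : R) : R :=
  Num.sqrt (A.[x] ^+ 2 + B.[x] ^+ 2).

Lemma coef_rcpoly (R : realType) (A B : {poly R}) i :
  (rcpoly A B)`_i = Complex A`_i B`_i.
Proof.
rewrite /rcpoly coefD coefZ !coef_map /=.
by apply/eqP; rewrite eq_complex /= !(mul0r, mul1r, mulr0, subr0, addr0, add0r) !eqxx.
Qed.

Lemma rcpolyP (R : realType) (Q : {poly R[i]}) : exists A B, Q = rcpoly A B.
Proof.
exists (\poly_(i < size Q) complex.Re Q`_i), (\poly_(i < size Q) complex.Im Q`_i).
apply/polyP => i; rewrite coef_rcpoly !coef_poly; case: ltnP => [_|h].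
  by case: (Q`_i).
by rewrite nth_default.
Qed.

Lemma deriv_rcpoly (R : realType) (A B : {poly R}) :
  (rcpoly A B)^`() = rcpoly A^`() B^`().
Proof. by rewrite /rcpoly derivD derivZ !deriv_map. Qed.

Lemma cabs_rcpoly (R : realType) (A B : {poly R}) (x : R) :
  cabs (rcpoly A B).[real_complex R x] = modulus A B x.
Proof.
rewrite /cabs; have -> : (rcpoly A B).[real_complex R x] = Complex A.[x] B.[x].
  rewrite /rcpoly hornerD hornerZ !horner_map; apply/eqP; rewrite eq_complex /=.
  by rewrite !(mul0r, mul1r, mulr0, subr0, addr0, add0r) !eqxx.
by rewrite normc_def.
Qed.

Lemma continuous_modulus (R : realType) (A B : {poly R}) :
  continuous (modulus A B).
Proof.
have -> : modulus A B = Num.sqrt \o horner (A ^+ 2 + B ^+ 2).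
  by apply/funext => x; rewrite /modulus /= hornerD !horner_exp.
by move=> x; apply: continuous_comp; [exact: continuous_horner|exact: sqrt_continuous].
Qed.

Lemma modulus_ge0 (R : realType) (A B : {poly R}) x : 0 <= modulus A B x.
Proof. exact: sqrtr_ge0. Qed.

Lemma modulus0 (R : realType) (A : {poly R}) x : modulus A 0 x = `|A.[x]|.
Proof. by rewrite /modulus horner0 expr0n addr0 sqrtr_sqr. Qed.

Lemma measurable_modulus_powR (R : realType) (p : R) (A B : {poly R}) :
  measurable_fun setT
    ((fun x => modulus A B x `^ p) : measurableTypeR R -> R).
Proof.
apply: (measurableT_comp (measurable_powR p)).
exact: continuous_measurable_fun (@continuous_modulus R A B).
Qed.

Lemma continuous_bounded_itv (R : realType) (f : R -> R) (a b : R) : a <= b ->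
  continuous f -> exists2 M, 0 < M & forall x, x \in `[a, b] -> f x <= M.
Proof.
move=> ab cf; have [u uab fu] := EVT_max ab (continuous_subspaceT cf).
exists (Num.max 1 (f u)); first by rewrite lt_max ltr01.
by move=> x /fu h; rewrite le_max h orbT.
Qed.

(** The endpoints are excluded along with the finitely many roots, so that the point found has a
    neighbourhood inside [[a, b]]. *)
Lemma infinite_support_not_root (R : realType)
    (mu : {measure set (measurableTypeR R) -> \bar R}) (a b : R) (N : {poly R}) :
    measure_support mu `<=` `[a, b] -> infinite_set (measure_support mu) ->
    N != 0 ->
  exists x, [/\ measure_support mu x, a < x < b & N.[x] != 0].
Proof.
move=> sab inf N0; apply: contrapT => noex; apply: inf.
apply: (sub_finite_set (B := [set` a :: b :: roots N a b])); last exact: finite_seq.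
move=> x sx /=; rewrite !inE; apply: contrapT => /negP.
rewrite !negb_or in_roots N0 andbT => /and3P[xa xb]; rewrite negb_and.
have := sab x sx; rewrite /= in_itv /= => /andP[ax xb'].
have axb : a < x < b by rewrite !lt_neqAle ax xb' xb eq_sym xa.
rewrite in_itv /= axb orbF => Nx; apply: noex; exists x; split=> //.
Qed.

(** The superlevel set within [(a, b)] is an open neighbourhood of a support point. It provides the
    set of positive measure on which a competitor gains. *)
Lemma support_charges_superlevel (R : realType)
    (mu : {finite_measure set (measurableTypeR R) -> \bar R}) (a b x0 h : R)
    (g : R -> R) :
    measure_support mu x0 -> a < x0 < b -> continuous g -> h < g x0 ->
  exists E : set (measurableTypeR R), [/\ measurable E, E `<=` `[a, b],
    forall x, E x -> h < g x & 0 < fine (mu E)].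
Proof.
move=> sx0 ax0b cg hg.
pose E : set R := `]a, b[ `&` [set x | h < g x].
have oE : open E.
  apply: openI; first exact: interval_open.
  by apply: (open_comp (f := g) (D := [set y | h < y])) => // ? _; exact: cg.
have mE : measurable (E : set (measurableTypeR R)) by exact: open_measurable.
exists E; split => //.
- by move=> x [/= + _]; rewrite !in_itv /= => /andP[/ltW -> /ltW ->].
- by move=> x [].
apply: fine_gt0; apply/andP; split.
  by apply: sx0 => //; split=> //=; rewrite in_itv.
by rewrite ltey_eq fin_num_measure.
Qed.

Lemma poweRV_le (R : realType) (p : R) (y z : \bar R) : 0 < p ->
  (0 <= y -> 0 <= z -> y `^ p^-1 <= z `^ p^-1 -> y <= z)%E.
Proof.
move=> p0 y0 z0 yz.
have powK (w : \bar R) : (0 <= w -> (w `^ p^-1) `^ p = w)%E.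
  by move=> w0; rewrite -poweRrM mulVf ?poweRe1 // gt_eqF.
rewrite -(powK y y0) -(powK z z0).
by apply: gt0_ler_poweR yz; rewrite ?ltW // in_itv /= poweR_ge0 ?leey.
Qed.

Lemma extremal_gap (R : realType) (p a b c d : R)
    (mu0 mu1 : {finite_measure set (measurableTypeR R) -> \bar R})
    (n : nat) (A B A1 B1 : {poly R}) (E : set (measurableTypeR R)) (k K : R) :
    1 < p -> a <= b -> c <= d ->
    extremal_poly p a b c d mu0 mu1 n (rcpoly A B) ->
    monic_of_degree n (rcpoly A1 B1) ->
    measurable E -> E `<=` `[a, b] -> 0 <= k -> 0 <= K ->
    (forall x, a <= x <= b ->
       modulus A1 B1 x `^ p + k * \1_E x <= modulus A B x `^ p + K) ->
    (forall x, c <= x <= d -> modulus A1^`() B1^`() x `^ p <=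
                              modulus A^`() B^`() x `^ p + K) ->
  k * fine (mu0 E) <= K * (fine (mu0 [set` `[a, b]]) + fine (mu1 [set` `[c, d]])).
Proof.
move=> p1 ab cd [_ extr] mon1 mE Eab k0 K0 le0 le1.
have p0 : 0 < p by lra.
have [N0 N00 leN0] := continuous_bounded_itv ab (@continuous_modulus R A1 B1).
have [N1 N10 leN1] := continuous_bounded_itv cd (@continuous_modulus R A1^`() B1^`()).
have mI (u v : R) : measurable ([set` `[u, v]] : set (measurableTypeR R)).
  exact: measurable_itv.
have leI : (\int[mu0]_(x in [set` `[a, b]]) (modulus A B x `^ p)%:E +
    \int[mu1]_(x in [set` `[c, d]]) (modulus A^`() B^`() x `^ p)%:E <=
    \int[mu0]_(x in [set` `[a, b]]) (modulus A1 B1 x `^ p)%:E +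
    \int[mu1]_(x in [set` `[c, d]]) (modulus A1^`() B1^`() x `^ p)%:E)%E.
  have := extr _ mon1; rewrite /sobolev_norm.
  have E0 (mu : {measure set (measurableTypeR R) -> \bar R}) D A2 B2 :
    (\int[mu]_(x in D) ((cabs (rcpoly A2 B2).[real_complex R x]) `^ p)%:E =
     \int[mu]_(x in D) (modulus A2 B2 x `^ p)%:E)%E.
    by under eq_integral do rewrite cabs_rcpoly.
  rewrite !deriv_rcpoly !E0 => leS.
  have Ip A2 B2 A3 B3 : (0 <= \int[mu0]_(x in `[a, b]) (modulus A2 B2 x `^ p)%:E +
      \int[mu1]_(x in `[c, d]) (modulus A3 B3 x `^ p)%:E)%E.
    by apply: adde_ge0; apply: integral_ge0 => x _; rewrite lee_fin powR_ge0.
  move: leS; apply: poweRV_le p0 (Ip _ _ _ _) (Ip _ _ _ _).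
have bound (A2 B2 : {poly R}) N x : modulus A2 B2 x <= N -> 0 < N ->
    modulus A2 B2 x `^ p <= N `^ p.
  move=> xN /ltW N0'; apply: ge0_ler_powR (ltW p0) _ _ _ _ xN => //.
  by rewrite nnegrE modulus_ge0.
have mm := @measurable_modulus_powR R p.
have pp (A2 B2 : {poly R}) x : 0 <= modulus A2 B2 x `^ p by exact: powR_ge0.
refine (@energy_gap R _ (measurableTypeR R) mu0 mu1 _ _ E _ _ _ _
  (N0 `^ p + N1 `^ p) k K (mI a b) (mI c d) mE Eab (mm A1 B1)
  (mm A1^`() B1^`()) (mm A B) (mm A^`() B^`()) (pp _ _) (pp _ _) (pp _ _)
  (pp _ _) _ _ k0 K0 _ _ leI) => x; rewrite /= in_itv /= => hx.
- by rewrite -[leLHS]addr0 lerD ?powR_ge0 // bound // leN0.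
- by rewrite -[leLHS]add0r lerD ?powR_ge0 // bound // leN1.
- exact: le0.
- exact: le1.
Qed.

Lemma monic_of_degree_rcpoly (R : realType) (n : nat) (A B : {poly R}) :
  monic_of_degree n (rcpoly A B) <->
  [/\ A \is monic, size A = n.+1 & (size B <= n)%N].
Proof.
have cAB i : (rcpoly A B)`_i = Complex A`_i B`_i := coef_rcpoly A B i.
split=> [[]|[]].
  rewrite monicE lead_coefE => + sP; rewrite sP cAB => /eqP[An Bn].
  have AB0 i : (n < i)%N -> A`_i = 0 /\ B`_i = 0.
    by move=> ni; have := cAB i; rewrite nth_default ?sP // => -[<- <-].
  have sA : size A = n.+1.
    apply/eqP; rewrite eqn_leq; apply/andP; split.
      by apply/leq_sizeP => i /AB0[].
    rewrite ltnNge; apply/negP => /leq_sizeP/(_ n (leqnn n)) /eqP.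
    by rewrite An oner_eq0.
  split=> //; first by rewrite monicE lead_coefE sA An.
  by apply/leq_sizeP => i; rewrite leq_eqVlt => /orP[/eqP <-|/AB0[]].
rewrite /monic_of_degree !monicE !lead_coefE => + sA sB; rewrite sA => An.
have sP : size (rcpoly A B) = n.+1.
  apply/eqP; rewrite eqn_leq; apply/andP; split.
    apply/leq_sizeP => i ni; rewrite cAB !nth_default ?sA //.
    exact: leq_trans sB (ltnW ni).
  rewrite ltnNge; apply/negP => /leq_sizeP/(_ n (leqnn n)); rewrite cAB.
  by case=> A0; move: An; rewrite A0 eq_sym oner_eq0.
by rewrite sP cAB /= (eqP An) (nth_default 0 sB) eqxx.
Qed.

(** The competitor is [A] alone: its modulus and that of its derivative never exceed the original
    ones, and its modulus is strictly smaller near a support point where [B] does not vanish. The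
    loss is [K = 0] while the gain is positive. *)
Lemma extremal_real (R : realType) (p a b c d : R)
    (mu0 mu1 : {finite_measure set (measurableTypeR R) -> \bar R})
    (n : nat) (A B : {poly R}) :
    1 < p -> a < b -> c <= d ->
    measure_support mu0 `<=` `[a, b] -> infinite_set (measure_support mu0) ->
    extremal_poly p a b c d mu0 mu1 n (rcpoly A B) ->
  B = 0.
Proof.
move=> p1 ab cd sab inf extr; apply/eqP/negPn/negP => B0.
have [x0 [sx0 x0ab Bx0]] := infinite_support_not_root sab inf B0.
have [monA sA sB] := (monic_of_degree_rcpoly n A B).1 extr.1.
have le_mod (A1 B1 : {poly R}) x : modulus A1 0 x <= modulus A1 B1 x.
  by rewrite ler_sqrt ?addr_ge0 ?sqr_ge0 // horner0 expr0n lerD2l sqr_ge0.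
pose g x := modulus A B x - modulus A 0 x.
have g0 : 0 < g x0.
  rewrite subr_gt0 ltr_sqrt ?horner0 ?expr0n /= ?addr0.
    by rewrite ltrDl lt_def sqr_ge0 sqrf_eq0 Bx0.
  by rewrite ltr_pwDr ?sqr_ge0 // lt_def sqr_ge0 sqrf_eq0 Bx0.
have cg : continuous g.
  by move=> x; apply: continuousB; exact: continuous_modulus.
have [|E [mE Eab gE muE]] := support_charges_superlevel (h := g x0 / 2) sx0 x0ab cg.
  by lra.
have [M M0 leM] := continuous_bounded_itv (ltW ab) (@continuous_modulus R A B).
pose h := g x0 / 2; have h0 : 0 < h by rewrite /h; lra.
have hE x : E x -> h < modulus A B x - modulus A 0 x by exact: gE.
have k0 : 0 < h * h `^ p / M by rewrite divr_gt0 // mulr_gt0 // powR_gt0.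
have p0 : 0 <= p by lra.
have := extremal_gap (A1 := A) (B1 := 0) (k := h * h `^ p / M) (K := 0) p1
  (ltW ab) cd extr _ mE Eab (ltW k0) (lexx 0).
rewrite mul0r leNgt mulr_gt0 // => H; suff : false by []; apply: H.
- by apply/monic_of_degree_rcpoly; rewrite size_poly0.
- move=> x xab; rewrite addr0 indicE; have [/set_mem xE|xE] := boolP (x \in E).
    have := hE _ xE; have mA0 := modulus_ge0 A 0 x => hx.
    rewrite mulr1; apply: powR_gain => //; try lra.
    by rewrite leM.
  rewrite mulr0 addr0; apply: ge0_ler_powR => //; rewrite nnegrE modulus_ge0 //.
move=> x xcd; rewrite addr0 deriv0; apply: ge0_ler_powR => //.
by rewrite nnegrE modulus_ge0.
by rewrite nnegrE modulus_ge0.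
Qed.

Lemma norm_subM (R : realDomainType) (u v t : R) : 0 <= u * v -> 0 <= t ->
  `|u - t * v| = `| `|u| - t * `|v| |.
Proof.
move=> uv t0; have [[u0 v0]|[u0 v0]] : (0 <= u /\ 0 <= v) \/ (u <= 0 /\ v <= 0).
- case: (ltgtP u 0) => u0.
  + by right; rewrite -(nmulr_rge0 _ u0).
  + by left; rewrite -(pmulr_rge0 _ u0).
  + by case: (leP 0 v) => [|/ltW] h; [left|right].
- by rewrite (ger0_norm u0) (ger0_norm v0).
- by rewrite (ler0_norm u0) (ler0_norm v0) -[LHS]normrN opprB mulrN opprK (addrC (- u)).
Qed.

(** If [t * v] overshoots [u], the remainder is at most [t * |v|]; this is the source of the error
    of order [t^p]. *)
Lemma norm_subM_le (R : realDomainType) (u v t : R) : 0 <= u * v -> 0 <= t ->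
  `|u - t * v| <= `|u| \/ `|u - t * v| <= t * `|v|.
Proof.
move=> uv t0; rewrite norm_subM //.
have u0 := normr_ge0 u; have tv0 : 0 <= t * `|v| by rewrite mulr_ge0.
have [h|h] := leP (t * `|v|) `|u|; [left|right].
  by rewrite ger0_norm ?subr_ge0 // gerBl.
by rewrite ltr0_norm ?subr_lt0 // opprB gerBl.
Qed.

Lemma norm_subM_ge (R : realDomainType) (u v t del : R) : 0 <= u * v -> 0 <= t ->
  del <= `|v| -> t * `|v| <= `|u| -> `|u - t * v| <= `|u| - t * del.
Proof.
move=> uv t0 dv tvu; rewrite norm_subM // ger0_norm ?subr_ge0 //.
by rewrite lerD2l lerN2 ler_wpM2l.
Qed.

(** The competitor [A - t Q] gains an amount linear in [t] on a set [E] where [A Q] stays away from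
    0, and loses at most [(t M)^p] pointwise. Extremality forces [C1 <= t^(p-1) C2] with [C1 > 0],
    which fails for small [t] since [p > 1]. *)
Lemma extremal_no_descent (R : realType) (p a b c d : R)
    (mu0 mu1 : {finite_measure set (measurableTypeR R) -> \bar R})
    (n : nat) (A : {poly R}) :
    1 < p -> a < b -> c <= d ->
    measure_support mu0 `<=` `[a, b] -> infinite_set (measure_support mu0) ->
    extremal_poly p a b c d mu0 mu1 n (rcpoly A 0) ->
  no_descent_direction a b c d n A.
Proof.
move=> p1 ab cd sab inf extr Q Q0 sQ AQ A'Q'.
have [monA sA _] := (monic_of_degree_rcpoly n A 0).1 extr.1.
have A0 : A != 0 by rewrite monic_neq0.
have [x0 [sx0 x0ab ABx0]] := infinite_support_not_root sab inf (mulf_neq0 A0 Q0).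
pose g x := modulus (A * Q) 0 x.
have gE x : g x = `|A.[x]| * `|Q.[x]| by rewrite /g modulus0 hornerM normrM.
have g0 : 0 < g x0 by rewrite gE -normrM -hornerM normr_gt0.
have [|E [mE Eab lt_g muE]] := support_charges_superlevel (h := g x0 / 2)
    sx0 x0ab (@continuous_modulus R (A * Q) 0); first by rewrite -/(g x0); lra.
have bnd (f : {poly R}) u v : u <= v -> exists2 M, 0 < M &
    forall x, u <= x <= v -> `|f.[x]| <= M.
  move=> uv; have [M M0 H] := continuous_bounded_itv uv (@continuous_modulus R f 0).
  by exists M => // x xuv; rewrite -modulus0 H.
have [M1 M10 leM1] := bnd A _ _ (ltW ab).
have [M2 M20 leM2] := bnd Q _ _ (ltW ab).
have [M3 M30 leM3] := bnd Q^`() _ _ cd.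
pose M := M1 + M2 + M3; have M0 : 0 < M by rewrite /M; lra.
(* On [E] the product of [|A|] and [|Q|] exceeds [g x0 / 2] and each factor is at most [M], so each
   is at least [del]. *)
pose del := g x0 / 2 / M; have del0 : 0 < del by rewrite !divr_gt0.
have AQE x : E x -> del <= `|A.[x]| /\ del <= `|Q.[x]|.
  move=> xE; have := lt_g _ xE; rewrite -/(g x) (gE x) => /ltW gx.
  have /= := Eab _ xE; rewrite in_itv /= => xab.
  have := leM1 _ xab; have := leM2 _ xab => q1 q2.
  split; rewrite ler_pdivrMr //; apply: le_trans gx _.
    by rewrite ler_wpM2l // /M; lra.
  by rewrite mulrC ler_wpM2l // /M; lra.
pose m := fine (mu0 E).
pose S := fine (mu0 [set` `[a, b]]) + fine (mu1 [set` `[c, d]]).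
have S0 : 0 <= S by rewrite addr_ge0 // fine_ge0.
have p0 : 0 <= p by lra.
pose C1 := del * del `^ p / M * m; pose C2 := M `^ p * S.
have C10 : 0 < C1 by rewrite !mulr_gt0 ?invr_gt0 // powR_gt0.
have C20 : 0 <= C2 by rewrite mulr_ge0 // powR_ge0.
have q0 : 0 < p - 1 by lra.
(* The bound on [t] ensures [t |Q| <= del <= |A|] on [E], so that subtracting [t Q] does not
   overshoot there. *)
have key t : 0 < t -> t <= del / M -> C1 <= t `^ (p - 1) * C2.
  move=> t0 tdel; rewrite -(ler_pM2l t0).
  have tM : t * M <= del by rewrite -ler_pdivlMr.
  have -> : t * C1 = (t * del) * del `^ p / M * m by rewrite /C1; ring.
  have -> : t * (t `^ (p - 1) * C2) = (t * M) `^ p * S.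
    rewrite mulrA mulr_powRB1 ?ltW //; last by lra.
    by rewrite /C2 powRM ?ltW // mulrA.
  have tM0 : 0 <= t * M by rewrite mulr_ge0 // ltW.
  have bound (u v : R) : 0 <= u * v -> `|v| <= M ->
      `|u - t * v| `^ p <= `|u| `^ p + (t * M) `^ p.
    move=> uv vM; have [h|h] := norm_subM_le uv (ltW t0).
      rewrite -[leLHS]addr0 lerD ?powR_ge0 //.
      by apply: ge0_ler_powR => //; rewrite nnegrE.
    rewrite -[leLHS]add0r lerD ?powR_ge0 //.
    apply: ge0_ler_powR => //; rewrite ?nnegrE //.
    by apply: le_trans h _; rewrite ler_wpM2l // ltW.
  apply: (extremal_gap (A1 := A - t *: Q) (B1 := 0) p1 (ltW ab) cd extr) => //.
  - apply/monic_of_degree_rcpoly.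
    have stQ : (size (- (t *: Q)) < size A)%N.
      by rewrite size_polyN sA ltnS (leq_trans (size_scale_leq _ _)).
    by split; rewrite ?size_poly0 ?size_polyDl ?monicE ?lead_coefDl.
  - exact: divr_ge0 (mulr_ge0 (mulr_ge0 (ltW t0) (ltW del0)) (powR_ge0 _ _)) (ltW M0).
  - exact: powR_ge0.
  - move=> x xab; rewrite !modulus0 hornerD hornerN hornerZ.
    have uv := AQ x xab; have uM := leM1 x xab; have vM := leM2 x xab.
    have [/set_mem xE|xE] := boolP (x \in E); rewrite indicE; last first.
      rewrite (negbTE xE) mulr0 addr0; apply: bound => //.
      by rewrite /M; lra.
    rewrite mem_set // mulr1; have [delu delv] := AQE x xE.
    apply: (@le_trans _ _ (`|A.[x]| `^ p)); last by rewrite lerDl powR_ge0.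
    apply: powR_gain => //; [exact: ltW|by rewrite mulr_ge0 // ltW| |
      by rewrite /M; lra].
    apply: norm_subM_ge uv (ltW t0) delv _.
    apply: le_trans (le_trans _ tM) delu; rewrite ler_pM2l //.
    by rewrite /M; lra.
  move=> x xcd; rewrite derivD derivN derivZ deriv0 !modulus0 hornerD hornerN hornerZ.
  apply: bound; first exact: A'Q'.
  by apply: le_trans (leM3 x xcd) _; rewrite /M; lra.
(* The test value is [t = r^(1/(p-1))]. The first term of the minimum keeps [t <= del / M]; the
   second makes [r C2 < C1], the [+ 1] avoiding a division by zero. *)
pose r := Num.min ((del / M) `^ (p - 1)) (C1 / (2 * (C2 + 1))).
have r0 : 0 < r.
  rewrite lt_min; apply/andP; split; first by apply: powR_gt0; exact: divr_gt0.
  by apply: divr_gt0 => //; lra.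
have rK : (r `^ (p - 1)^-1) `^ (p - 1) = r.
  by rewrite -powRrM mulVf ?gt_eqF // powRr1 // ltW.
have := key (r `^ (p - 1)^-1) (powR_gt0 _ r0); rewrite rK => /(_ _).
have h1 : r `^ (p - 1)^-1 <= del / M.
  have dM : 0 <= del / M by rewrite divr_ge0 ?ltW.
  have -> : del / M = ((del / M) `^ (p - 1)) `^ (p - 1)^-1.
    by rewrite -powRrM mulfV ?gt_eqF // powRr1.
  apply: ge0_ler_powR; rewrite ?nnegrE ?invr_ge0 ?powR_ge0 ?(ltW q0) ?(ltW r0) //.
  by rewrite ge_min lexx.
move=> /(_ h1) C1r.
have : r <= C1 / (2 * (C2 + 1)) by rewrite ge_min lexx orbT.
rewrite ler_pdivlMr; last by lra.
nra.
Qed.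

(** * Location of the zeros *)

Lemma cabsE (R : realType) (z : R[i]) :
  cabs z = Num.sqrt (complex.Re z ^+ 2 + complex.Im z ^+ 2).
Proof. by rewrite /cabs normc_def. Qed.

Lemma sqr_le_cabs (R : realType) (r : R) (z : R[i]) : 0 <= r -> r <= cabs z ->
  r ^+ 2 <= complex.Re z ^+ 2 + complex.Im z ^+ 2.
Proof.
move=> r0; rewrite cabsE -[X in X <= _](ger0_norm r0) -sqrtr_sqr.
by rewrite ler_sqrt // addr_ge0 ?sqr_ge0.
Qed.

(** The difference of squared distances is affine in [y], so it is enough that it be positive at the
    ends [a] and [d]. There [x - a < b - a] and [d - x < d - a] meet the two hypotheses. *)
Lemma bisector_interval (R : realFieldType) (a b d x u v y : R) :
    a < x < b -> b <= d -> a <= y <= d ->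
    (b - a) ^+ 2 <= (u - a) ^+ 2 + v ^+ 2 ->
    (d - a) ^+ 2 <= (u - d) ^+ 2 + v ^+ 2 ->
  (x - y) ^+ 2 < (u - y) ^+ 2 + v ^+ 2.
Proof.
move=> /andP[ax xb] bd /andP[ay yd] ha hd.
pose f t := (u - t) ^+ 2 + v ^+ 2 - (x - t) ^+ 2.
have fa : 0 < f a by rewrite /f; nra.
have fd : 0 < f d by rewrite /f; nra.
have ad : 0 < d - a by lra.
have fE : f y * (d - a) = f a * (d - y) + f d * (y - a) by rewrite /f; ring.
suff : 0 < f y by rewrite subr_gt0.
rewrite -(pmulr_lgt0 _ ad) fE; have [->|ya] := eqVneq y a.
  by rewrite subrr mulr0 addr0 mulr_gt0.
apply: ltr_wpDl; first by apply: mulr_ge0; [exact: ltW|rewrite subr_ge0].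
by rewrite mulr_gt0 // subr_gt0 lt_neqAle eq_sym ya.
Qed.

Lemma root_real_critical (R : realType) (A : {poly R}) (ys : seq R) (y : R[i]) :
    A^`() != 0 -> A^`() = lead_coef A^`() *: \prod_(t <- ys) ('X - t%:P) ->
    root (map_poly (real_complex R) A)^`() y ->
  exists2 t, t \in ys & y = real_complex R t.
Proof.
move=> A'0 A'E; rewrite deriv_map A'E map_polyZ /= rootZ; last first.
  by rewrite fmorph_eq0 lead_coef_eq0.
rewrite rmorph_prod /=; under eq_bigr do rewrite map_polyXsubC.
rewrite -(big_map (real_complex R) xpredT (fun t => 'X - t%:P)).
by rewrite root_prod_XsubC => /mapP.
Qed.

(** A zero [z] outside both discs would be farther than [x0] from every point of [[a, d]], hence
    from every critical point, and [grace_bisector] would give [A] different values at its zeros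
    [x0] and [z]. *)
Lemma real_zeros_in_discs (R : realType) (a b c d : R) (n : nat) (A : {poly R}) :
    b <= c -> a < b -> c <= d -> (0 < n)%N -> size A = n.+1 ->
    no_descent_direction a b c d n A ->
  forall z, root (map_poly (real_complex R) A) z ->
    disc d (d - a) z \/ disc a (b - a) z.
Proof.
move=> bc ab cd n0 sA nodesc z Az.
have [x0 [ys [x0ab Ax0 A'E ysad]]] := real_critical_points bc ab cd n0 sA nodesc.
apply: contrapT => /not_orP[]; rewrite /disc /= => /negP + /negP.
rewrite -!leNgt => hd ha.
have bd : b <= d by exact: le_trans cd.
have {}hd : (d - a) ^+ 2 <= (complex.Re z - d) ^+ 2 + complex.Im z ^+ 2.
  have := sqr_le_cabs _ hd; rewrite subr_ge0 (le_trans (ltW ab) bd) => /(_ isT).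
  by case: (z) => u v /=; rewrite subr0.
have {}ha : (b - a) ^+ 2 <= (complex.Re z - a) ^+ 2 + complex.Im z ^+ 2.
  have := sqr_le_cabs _ ha; rewrite subr_ge0 (ltW ab) => /(_ isT).
  by case: (z) => u v /=; rewrite subr0.
have A'0 : A^`() != 0.
  by rewrite -size_poly_eq0 polyorder.size_deriv sA -lt0n.
have closer y : a <= y <= d ->
    `|real_complex R x0 - real_complex R y| < `|z - real_complex R y|.
  move=> yad; have := bisector_interval x0ab bd yad ha hd.
  rewrite !normc_def ltcR; case: (z) => u v /= h.
  rewrite ltr_sqrt !(oppr0, addr0, subr0) ?expr0n ?addr0 //.
  by apply: le_lt_trans h; exact: sqr_ge0.
have xz : real_complex R x0 != z.
  have := closer a; rewrite lexx (le_trans (ltW ab) bd) => /(_ isT).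
  by apply: contraTneq => ->; rewrite ltxx.
have sP : (1 < size (map_poly (real_complex R) A))%N.
  by rewrite size_map_poly sA ltnS.
have := grace_bisector xz sP.
rewrite (rootP Az) horner_map (rootP Ax0) rmorph0 eqxx => H; suff : false by [].
by apply: H => y /(root_real_critical A'0 A'E)[t /ysad tad ->]; exact: closer.
Qed.

(** Under [x |-> - x] both derivatives change sign, so their product keeps its sign. *)
Lemma no_descent_direction_opp (R : realType) (a b c d : R) (n : nat)
    (A : {poly R}) :
  no_descent_direction a b c d n A ->
  no_descent_direction (- b) (- a) (- d) (- c) n (A \Po - 'X).
Proof.
have hN (p : {poly R}) x : (p \Po - 'X).[x] = p.[- x].
  by rewrite horner_comp hornerN hornerX.
have dN (p : {poly R}) : (p \Po - 'X)^`() = - (p^`() \Po - 'X).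
  by rewrite deriv_comp derivN derivX mulrN1.
have sX : size (- 'X : {poly R}) = 2 by rewrite size_polyN size_polyX.
move=> nodesc Q Q0 sQ AQ A'Q'; apply: (nodesc (Q \Po - 'X)).
- by rewrite -size_poly_eq0 size_comp_poly2 // size_poly_eq0.
- by rewrite size_comp_poly2.
- move=> x xab; have := AQ (- x); rewrite !hN opprK; apply; lra.
move=> x xcd; have := A'Q' (- x).
rewrite !dN !(hornerN, hN) opprK mulNr mulrN; apply; lra.
Qed.

Theorem corollary3p1 (R : realType) (p a b c d : R)
  (mu0 mu1 : {finite_measure set (measurableTypeR R) -> \bar R})
  (n : nat) (L : {poly R[i]}) :
  1 < p -> a < b -> c <= d ->
  measure_support mu0 `<=` `[a, b] ->
  measure_support mu1 `<=` `[c, d] ->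
  infinite_set (measure_support mu0) ->
  interior (`[a, b] : set R) `&` interior (`[c, d] : set R) = set0 ->
  b <= c \/ d <= a ->
  (1 <= n)%N ->
  extremal_poly p a b c d mu0 mu1 n L ->
  forall z : R[i], root L z -> D_Delta a b c d z.
Proof.
move=> p1 ab cd sab _ inf _ bcda n1 extr z Lz.
have [A [B LE]] := rcpolyP L; subst L.
have B0 := extremal_real p1 ab cd sab inf extr; subst B.
have [_ sA _] := (monic_of_degree_rcpoly n A 0).1 extr.1.
have nodesc := extremal_no_descent p1 ab cd sab inf extr.
have {}Lz : root (map_poly (real_complex R) A) z.
  by move: Lz; rewrite /rcpoly map_poly0 scaler0 addr0.
rewrite /D_Delta; case: ifP => bc.
  exact: real_zeros_in_discs bc ab cd n1 sA nodesc z Lz.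
have da : d <= a by case: bcda => //; rewrite bc.
(* Reflection exchanges the two configurations: [d <= a] becomes [- a <= - d], and the discs about
   [- c] and [- b] are reflected back to those about [c] and [b]. *)
have sA' : size (A \Po - 'X) = n.+1.
  by rewrite size_comp_poly2 ?size_polyN ?size_polyX.
have Lz' : root (map_poly (real_complex R) (A \Po - 'X)) (- z).
  rewrite map_comp_poly rmorphN /= map_polyX.
  by apply/rootP; rewrite horner_comp hornerN hornerX opprK; apply/rootP.
have cabsN (w : R[i]) : cabs (- w) = cabs w by rewrite /cabs normrN.
have discN (w r : R) : disc (- w) r (- z) = disc w r z.
  by rewrite /disc /= rmorphN /= -opprD cabsN.
have := real_zeros_in_discs (a := - b) (b := - a) (c := - d) (d := - c) _ _ _ n1
  sA' (no_descent_direction_opp nodesc) Lz'.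
rewrite !lerN2 ltrN2 !opprK !discN => /(_ da ab cd) [h|h]; [left|right].
  by move: h; rewrite addrC.
by move: h; rewrite addrC.
Qed.
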